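(* Let $p$ be the transition function of an arbitrary Markov chain on an arbitrary measurable space $(X,\Sigma)$. Then the Doeblin condition $(D)$: there exist a bounded measure $\varphi\in ca(X,\Sigma)$, $\varphi\ge 0$, a number $\varepsilon>0$ and an integer $k\ge 1$ such that for every $E\in\Sigma$, $\varphi(E)\le\varepsilon$ implies $p^k(x,E)\le 1-\varepsilon$ for all $x\in X$, is equivalent to the condition $( * )$: $\Delta_{ba}\subset ca(X,\Sigma)$, which means that all invariant finitely additive measures of the chain are countably additive, or, in other words, that the chain has no invariant purely finitely additive measures.
   Context: $X$ is an arbitrary infinite set and $\Sigma$ is a $\sigma$-algebra of subsets of $X$ containing all singletons. $B(X,\Sigma)$ is the Banach space of bounded $\Sigma$-measurable functions $f:X\to\mathbb{R}$ with the sup-norm. $ba(X,\Sigma)$ is the Banach space of bounded finitely additive measures $\mu:\Sigma\to\mathbb{R}$ with the total variation norm, and $ca(X,\Sigma)$ is its subspace of countably additive measures. A nonnegative $\mu\in ba(X,\Sigma)$ is purely finitely additive if the only countably additive $\lambda$ with $0\le\lambda\le\mu$ is $\lambda=0$; a signed $\mu$ is purely finitely additive if both parts $\mu^+,\mu^-$ of its Jordan decomposition are. $S_{ba}=\{\mu\in ba(X,\Sigma):\mu\ge 0,\ \|\mu\|=1\}$. A Markov chain is given by a transition function $p(x,E)$, $x\in X$, $E\in\Sigma$, with $0\le p(x,E)\le 1$, $p(x,X)=1$, $p(\cdot,E)\in B(X,\Sigma)$ for all $E\in\Sigma$, and $p(x,\cdot)\in ca(X,\Sigma)$ for all $x\in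 X$. Its iterates are $p^1=p$, $p^{k+1}(x,E)=\int_X p^k(y,E)\,p(x,dy)$. The Markov operator $A:ba(X,\Sigma)\to ba(X,\Sigma)$ is $A\mu(E)=\int_X p(x,E)\,\mu(dx)$. A measure $\mu\in S_{ba}$ is invariant if $A\mu=\mu$, and $\Delta_{ba}=\{\mu\in S_{ba}: A\mu=\mu\}$. *)

(* Defs.v *)
From HB Require Import structures.
From mathcomp Require Import all_boot all_order all_algebra.
From mathcomp Require Import all_classical all_reals all_analysis.

Set Implicit Arguments.
Unset Strict Implicit.
Unset Printing Implicit Defensive.

Import Order.TTheory GRing.Theory Num.Theory.
Import numFieldNormedType.Exports.

Local Open Scope classical_set_scope.
Local Open Scope ring_scope.
Local Open Scope ereal_scope.

(* Set functions take values in \bar R, as in the library, and only their values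
   on measurable sets are meaningful. An additive charge is finitely additive
   and finite-valued on measurable sets; on a sigma-algebra this does not imply
   that it is bounded, so boundedness is a separate requirement. *)

Section bounded_additive_measures.
Context d (X : measurableType d) (R : realType).

Definition ba : set (additive_charge X R) :=
  [set mu | exists M : R, forall E, measurable E -> `|mu E| <= M%:E].

Definition ca : set (additive_charge X R) :=
  [set mu | ba mu /\ semi_sigma_additive mu].

Definition tv_norm (mu : set X -> \bar R) : \bar R :=
  ereal_sup [set t | exists (n : nat) (F : nat -> set X),
    [/\ forall i, measurable (F i), trivIset setT F &
        t = \sum_(i < n) `|mu (F i)| ]].

(* Jordan decomposition of a finitely additive mu: mu^+ = mu \/ 0 and
   mu^- = (- mu) \/ 0 in the vector lattice ba. There need not be a Hahn
   decomposition, hence the suprema over measurable subsets. *)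
Definition jordan_ba_pos (mu : set X -> \bar R) (E : set X) : \bar R :=
  ereal_sup [set mu F | F in [set F | measurable F /\ F `<=` E]].

Definition jordan_ba_neg (mu : set X -> \bar R) (E : set X) : \bar R :=
  jordan_ba_pos (fun F => - mu F) E.

(* A countably additive lambda with 0 <= lambda <= mu is a finite measure. *)
Definition nonneg_purely_finitely_additive (mu : set X -> \bar R) : Prop :=
  forall lambda : {finite_measure set X -> \bar R},
    (forall E, measurable E -> lambda E <= mu E) ->
    forall E, measurable E -> lambda E = 0.

Definition purely_finitely_additive (mu : set X -> \bar R) : Prop :=
  nonneg_purely_finitely_additive (jordan_ba_pos mu) /\
  nonneg_purely_finitely_additive (jordan_ba_neg mu).

Definition S_ba : set (additive_charge X R) :=
  [set mu | [/\ ba mu, forall E, measurable E -> 0 <= mu E & tv_norm mu = 1]].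

(* Integral of a bounded measurable f against mu in ba. For a nonnegative
   finitely additive mu, the library integral of a nonnegative f is the supremum
   of the integrals of the simple functions below f; when f is bounded and
   measurable this is the limit along any sequence of simple functions
   converging uniformly to f. The library integral does not make sense for a
   signed set function, hence the use of the Jordan parts. *)
Definition ba_integral (mu : set X -> \bar R) (f : X -> \bar R) : \bar R :=
  \int[jordan_ba_pos mu]_x f x - \int[jordan_ba_neg mu]_x f x.

End bounded_additive_measures.

Arguments ba {d X R}.
Arguments ca {d X R}.
Arguments S_ba {d X R}.

Section markov_chain.
Context d (X : measurableType d) (R : realType).

(* Only the values at k >= 1 are the iterates p^k of a transition function;
   k = 0 is given the usual convention. *)
Fixpoint transition_iter (p : R.-pker X ~> X) (k : nat) (x : X) (E : set X)
    : \bar R :=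
  match k with
  | 0%N => \d_x E
  | 1%N => p x E
  | k'.+1 => \int[p x]_y transition_iter p k' y E
  end.

Definition markov_operator (p : R.-pker X ~> X) (mu : set X -> \bar R)
    (E : set X) : \bar R :=
  ba_integral mu (fun x => p x E).

Definition Delta_ba (p : R.-pker X ~> X) : set (additive_charge X R) :=
  [set mu | S_ba mu /\
            forall E, measurable E -> markov_operator p mu E = mu E].

Definition doeblin_condition (p : R.-pker X ~> X) : Prop :=
  exists (phi : {finite_measure set X -> \bar R}) (eps : R) (k : nat),
    [/\ (0 < eps)%R, (1 <= k)%N &
      forall E, measurable E -> phi E <= eps%:E ->
        forall x, transition_iter p k x E <= (1 - eps)%:E].

End markov_chain.

(* Main.v *)
Require Import Defs.
From HB Require Import structures.
From mathcomp Require Import all_boot all_order all_algebra.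
From mathcomp Require Import finmap.
From mathcomp Require Import all_classical all_reals all_analysis.
From mathcomp Require Import measurable_realfun ring lra.

(** Everything is phrased for contents [c] (nonnegative finitely additive set
    functions) of total mass 1 that are stationary: the integral of [p(., E)]
    against [c] is [c E].

    The Caratheodory outer measure of a stationary [c] restricts to the largest
    measure below [c], and is again stationary; so if [c] is not countably
    additive, the normalised difference [q] is stationary and purely finitely
    additive.  Such a [q] lives on sets [E] that are arbitrarily small for any
    given finite measure [phi]; then [q E <= \int p^k(x, E) q(dx) <= 1 - eps]
    contradicts the Doeblin condition.

    Conversely, suppose that all stationary contents are measures and that the
    Doeblin condition fails.  For a stationary measure [phi], apply the failure
    to [phi] for each [n]: this gives sets [G_n] with [phi G_n <= 2^-(n+1)] and
    points [x_n] whose Cesaro means of [p(x_n, .), ..., p^(n+1)(x_n, .)] charge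
    [G_n] with mass tending to 1.  An ultralimit of these means is a stationary
    probability concentrated on [limsup G_n], which is [phi]-null.  Iterating
    gives a sequence of mutually singular stationary probabilities, and an
    ultralimit of that sequence is stationary but not countably additive. *)

Set Implicit Arguments.
Unset Strict Implicit.
Unset Printing Implicit Defensive.

Import Order.TTheory GRing.Theory Num.Theory.
Import numFieldNormedType.Exports.
Import HBNNSimple.

Local Open Scope classical_set_scope.
Local Open Scope ring_scope.
Local Open Scope ereal_scope.

(** * Contents built from real-valued additive set functions *)

Section content_of_additive.
Context d (X : measurableType d) (R : realType).
Variable f : set X -> R.

Definition nonneg_additive :=
  (forall E, measurable E -> (0 <= f E)%R) /\
  (forall A B, measurable A -> measurable B -> A `&` B = set0 ->
    f (A `|` B) = (f A + f B)%R).

(** The value 0 off the measurable sets is forced by the interface: a content is nonnegative on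
    every set. The anonymous proof argument lets the content structure be attached to the
    function. *)
Definition additive_content & nonneg_additive : set X -> \bar R :=
  fun E => if `[< measurable E >] then (f E)%:E else 0.

Hypothesis fa : nonneg_additive.
Local Notation c := (additive_content fa).

Lemma additive_contentE E : measurable E -> c E = (f E)%:E.
Proof. by move=> mE; rewrite /additive_content asboolT. Qed.

Let c_ge0 E : 0 <= c E.
Proof.
rewrite /additive_content; case: asboolP => // mE.
by rewrite lee_fin; case: fa => f0 _; exact: f0.
Qed.

Let c_additive : measure_function.semi_additive c.
Proof.
case: (fa) => f0 fD.
have c0 : c set0 = 0.
  rewrite additive_contentE//; have := fD set0 set0 measurable0 measurable0.
  by rewrite setU0 setI0 => /(_ erefl) h; congr EFin; lra.
apply/(additive2P c0) => A B mA mB AB.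
rewrite !additive_contentE//; last exact: measurableU.
by rewrite fD.
Qed.

HB.instance Definition _ := isContent.Build d X R c c_ge0 c_additive.

End content_of_additive.

(** * Integrals of simple functions against a finite content *)

Section content_lemmas.
Context d (X : measurableType d) (R : realType).
Variable c : {content set X -> \bar R}.

Lemma le_content A B : measurable A -> measurable B -> A `<=` B -> c A <= c B.
Proof. by move=> mA mB AB; apply: le_measure => //; rewrite inE. Qed.

Lemma contentU A B : measurable A -> measurable B -> A `&` B = set0 ->
  c (A `|` B) = c A + c B.
Proof. by move=> mA mB AB; exact: measureU. Qed.

Lemma fin_content E : c setT \is a fin_num -> measurable E -> c E \is a fin_num.
Proof.
move=> cf mE; rewrite ge0_fin_numE//.
by rewrite (le_lt_trans (le_content mE measurableT _))// -ge0_fin_numE.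
Qed.

Lemma measurable_simple_preimage (T : choiceType) (h : X -> T) (S : set T) :
  finite_set (range h) -> (forall t, measurable (h @^-1` [set t])) ->
  measurable (h @^-1` S).
Proof.
move=> hfin mh.
rewrite (_ : _ @^-1` _ = \bigcup_(t in range h `&` S) (h @^-1` [set t])).
  by apply: fin_bigcup_measurable => // ; exact: finite_setIl.
apply/seteqP; split=> [x /= Sx|x [t [_ St] /= ->//]].
by exists (h x) => //; split.
Qed.

(* The measure is a combination of Dirac masses, one in each nonempty fibre. *)
Lemma content_eq_measure_on_fibres (T : choiceType) (h : X -> T) :
  c setT \is a fin_num ->
  finite_set (range h) -> (forall t, measurable (h @^-1` [set t])) ->
  exists m : {measure set X -> \bar R},
    forall S, m (h @^-1` S) = c (h @^-1` S).
Proof.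
move=> cfin hfin mh.
have mS S : measurable (h @^-1` S) by exact: measurable_simple_preimage.
suff H (s : seq T) : exists m : {measure set X -> \bar R},
    forall S, m (h @^-1` S) = c (h @^-1` (S `&` [set` s])).
  have /finite_seqP[s hs] := hfin; have [m mE] := H s.
  exists m => S; rewrite mE -hs; congr (c _).
  by apply/seteqP; split => x /=; [case|move=> Sx; split => //; exists x].
elim: s => [|t s [m mE]].
  exists mzero => S; rewrite /= (_ : _ `&` _ = set0) ?preimage_set0 ?measure0//.
  by apply/seteqP; split => // y [].
(* A value already listed, or one with empty fibre, adds nothing; a new value [t] adds the mass of
   its fibre at a point [x] of that fibre. *)
have [ts|ts] := boolP (t \in s).
  exists m => S; rewrite mE; congr (c (h @^-1` (_ `&` _))).
  apply/seteqP; split => y /=; rewrite inE; first by move=> ->; rewrite orbT.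
  by case/orP => // /eqP ->.
have [[x xt]|nt] := pselect (exists x, h x = t); last first.
  exists m => S; rewrite mE; congr (c _).
  apply/seteqP; split => y /= [Sy]; rewrite inE; first by move=> ->; rewrite orbT.
  by case/orP => // /eqP hy; case: nt; exists y.
have ct0 : (0 <= fine (c (h @^-1` [set t])))%R by exact: fine_ge0.
exists (measure_add m (mscale (NngNum ct0) (dirac x))) => S.
rewrite [LHS](_ : _ = m (h @^-1` S) + mscale (NngNum ct0) (dirac x) (h @^-1` S)); last first.
  exact: measure_addE.
rewrite mE /= /mscale/= fineK; last exact: fin_content.
rewrite diracE.
have [St|St] := pselect (S t); last first.
  rewrite memNset; last by rewrite /= xt.
  rewrite mule0 adde0; congr (c _); apply/seteqP; split => y /= [Sy].
    by rewrite inE => ->; rewrite orbT.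
  by rewrite inE => /orP[/eqP hy|//]; rewrite hy in Sy.
rewrite mem_set ?mule1; last by rewrite /= xt.
rewrite -contentU//.
  congr (c _); apply/seteqP; split => y /=; rewrite inE.
    by case=> [[Sy ->]|->]; rewrite ?orbT ?eqxx.
  by case=> Sy /orP[/eqP|]; [right|left].
by apply/seteqP; split => y //= [[_ hs] ht]; rewrite ht (negbTE ts) in hs.
Qed.

(** Simple functions of [f] and [g] only see the finitely many fibres of the pair [(f, g)], where a
    content cannot be told from a measure. One [m] serves every [k], so identities and inequalities
    between integrals of simple functions carry over from measures. *)
Lemma sintegral_eq_measure (f g : {nnsfun X >-> R}) :
  c setT \is a fin_num ->
  exists2 m : {measure set X -> \bar R}, m setT = c setT &
    forall k : R -> R -> R, sintegral c (fun x => k (f x) (g x)) =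
      sintegral m (fun x => k (f x) (g x)).
Proof.
move=> cfin; pose h x := (f x, g x).
have [||m mE] := @content_eq_measure_on_fibres _ h cfin.
- apply: (@sub_finite_set _ _ (range f `*` range g)); last exact: finite_setX.
  by move=> _ [x _ <-] /=; split; exists x.
- move=> [a b]; rewrite (_ : _ @^-1` _ = f @^-1` [set a] `&` g @^-1` [set b]).
    exact: measurableI.
  by apply/seteqP; split => x /=; [case=> -> ->|case=> <- <-].
exists m => [|k]; first exact: mE setT.
apply: eq_fsbigr => y _; congr (_ * _).
by have /esym := mE [set p | k p.1 p.2 = y].
Qed.

Lemma content_sintegralD (f g : {nnsfun X >-> R}) : c setT \is a fin_num ->
  sintegral c (f \+ g)%R = sintegral c f + sintegral c g.
Proof.
move=> cfin; have [m _ E] := sintegral_eq_measure f g cfin.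
by rewrite (E (fun a b => a + b)%R) (E (fun a _ => a)) (E (fun _ b => b)) -sintegralD.
Qed.

Lemma content_le_sintegral (f g : {nnsfun X >-> R}) : c setT \is a fin_num ->
  (forall x, (f x <= g x)%R) -> sintegral c f <= sintegral c g.
Proof.
move=> cfin fg; have [m _ E] := sintegral_eq_measure f g cfin.
by rewrite (E (fun a _ => a)) (E (fun _ b => b)); exact: le_sintegral.
Qed.

Lemma content_sintegral_cst (r : {nonneg R}) : c setT \is a fin_num ->
  sintegral c (cst_nnsfun X r) = r%:num%:E * c setT.
Proof.
move=> cfin; have [m mT E] := sintegral_eq_measure nnsfun0 nnsfun0 cfin.
rewrite (E (fun _ _ => r%:num)) -mT -(integral_cst m measurableT).
exact: esym (integralT_nnsfun m (cst_nnsfun X r)).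
Qed.

Lemma content_sintegralZ (r : R) (f : {nnsfun X >-> R}) :
  c setT \is a fin_num ->
  sintegral c (cst r \* f)%R = r%:E * sintegral c f.
Proof.
move=> cfin; have [m _ E] := sintegral_eq_measure f f cfin.
by rewrite (E (fun a _ => r * a)%R) (E (fun a _ => a)) -sintegralrM.
Qed.

Lemma content_sintegral_ge0 (f : {nnsfun X >-> R}) : c setT \is a fin_num ->
  0 <= sintegral c f.
Proof.
move=> cfin; have [m _ E] := sintegral_eq_measure f f cfin.
by rewrite (E (fun a _ => a)); exact: sintegral_ge0.
Qed.

Lemma content_sintegral_fin (f : {nnsfun X >-> R}) : c setT \is a fin_num ->
  sintegral c f \is a fin_num.
Proof.
move=> cfin; have [K fK] : exists K : {nonneg R}, forall x, (f x <= K%:num)%R.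
  have [M [_ Mf]] := simple_bounded f.
  have K0 : (0 <= Num.max 0 (M + 1))%R by rewrite le_max lexx.
  exists (NngNum K0) => x /=; rewrite le_max; apply/orP; right.
  by apply: le_trans (ler_norm _) _; apply: (Mf (M + 1)%R) => //; rewrite ltrDl.
rewrite ge0_fin_numE ?content_sintegral_ge0//.
rewrite (@le_lt_trans _ _ (sintegral c (cst_nnsfun X K)))//.
  exact: content_le_sintegral.
by rewrite content_sintegral_cst// -ge0_fin_numE ?fin_numM// mule_ge0.
Qed.

End content_lemmas.

(** * Integrals of nonnegative functions against a finite content *)

Section content_integral.
Context d (X : measurableType d) (R : realType).
Implicit Type f g : X -> \bar R.

Lemma eq_integral_on_measurable (mu nu : set X -> \bar R) f :
  (forall E, measurable E -> mu E = nu E) ->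
  \int[mu]_x f x = \int[nu]_x f x.
Proof.
move=> munu.
have E (h : {nnsfun X >-> R}) : sintegral mu h = sintegral nu h.
  by apply: eq_fsbigr => y _; rewrite munu.
rewrite /integral; congr (ereal_sup _ - ereal_sup _);
  by apply: eq_imagel => h _; exact: E.
Qed.

Variable c : {content set X -> \bar R}.
Hypothesis cfin : c setT \is a fin_num.

(** The negative part of [f] is 0, and a simple function below 0 has integral 0, so only the first
    supremum in the definition of the integral remains. *)
Lemma content_integralE f : (forall x, 0 <= f x) ->
  \int[c]_x f x = ereal_sup [set sintegral c h |
    h in [set h : {nnsfun X >-> R} | forall x, (h x)%:E <= f x]].
Proof.
move=> f0; rewrite /integral patch_setT.
rewrite (_ : (fun x : X => f x) ^\+ = f); last first.
  by apply/funext => x; exact: (ge0_funeposE (D := setT)) (in_setT x).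
rewrite (_ : (fun x : X => f x) ^\- = cst 0); last first.
  by apply/funext => x; exact: (ge0_funenegE (D := setT)) (in_setT x).
rewrite [X in _ - X](_ : _ = 0) ?sube0//.
apply/eqP; rewrite eq_le; apply/andP; split.
  apply: ge_ereal_sup => _ [h /= h0 <-].
  have := content_le_sintegral cfin (fun x => h0 x : (h x <= (nnsfun0 : {nnsfun X >-> R}) x)%R).
  by rewrite content_sintegral_cst// mul0e.
apply: ereal_sup_ubound; exists nnsfun0 => //.
by rewrite content_sintegral_cst// mul0e.
Qed.

Lemma content_sintegral_le_integral f (h : {nnsfun X >-> R}) :
  (forall x, (h x)%:E <= f x) -> sintegral c h <= \int[c]_x f x.
Proof.
move=> hf; rewrite content_integralE.
  by apply: ereal_sup_ubound; exists h.
by move=> x; apply: le_trans (hf x); rewrite lee_fin.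
Qed.

Lemma content_integral_nnsfun (h : {nnsfun X >-> R}) :
  \int[c]_x (h x)%:E = sintegral c h.
Proof.
apply/eqP; rewrite eq_le; apply/andP; split; last exact: content_sintegral_le_integral.
rewrite content_integralE; last by move=> x; rewrite lee_fin.
apply: ge_ereal_sup => _ [g /= gh <-].
by apply: content_le_sintegral => // x; rewrite -lee_fin.
Qed.

Lemma content_integral_ge0 f : (forall x, 0 <= f x) -> 0 <= \int[c]_x f x.
Proof.
move=> f0; have := @content_sintegral_le_integral f nnsfun0 f0.
by rewrite content_sintegral_cst// mul0e.
Qed.

Lemma content_le_integral f g : (forall x, 0 <= f x) ->
  (forall x, f x <= g x) -> \int[c]_x f x <= \int[c]_x g x.
Proof.
move=> f0 fg; rewrite (content_integralE f0).
apply: ge_ereal_sup => _ [h /= hf <-].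
by apply: content_sintegral_le_integral => x; exact: le_trans (hf x) (fg x).
Qed.

Lemma content_integral_le_cst f (r : R) : (forall x, 0 <= f x <= r%:E) ->
  \int[c]_x f x <= r%:E * c setT.
Proof.
move=> fr; have r0 : (0 <= r)%R.
  by have /andP[f0 f1] := fr point; rewrite -lee_fin (le_trans f0).
rewrite -(content_sintegral_cst (NngNum r0))// -content_integral_nnsfun.
by apply: content_le_integral => x; have /andP[] := fr x.
Qed.

Lemma content_integral_fin f : (forall x, 0 <= f x <= 1) ->
  \int[c]_x f x \is a fin_num.
Proof.
move=> f01; rewrite ge0_fin_numE; last first.
  by apply: content_integral_ge0 => x; have /andP[] := f01 x.
rewrite (le_lt_trans (content_integral_le_cst f01))// mul1e.
by rewrite -ge0_fin_numE.
Qed.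

(** Simple functions below [f] and [g] add up to one below [f + g]. This half of additivity asks for
    no measurability. *)
Lemma content_le_integralD f g : (forall x, 0 <= f x) -> (forall x, 0 <= g x) ->
  \int[c]_x f x + \int[c]_x g x <= \int[c]_x (f x + g x).
Proof.
move=> f0 g0; rewrite (content_integralE f0) (content_integralE g0).
set If := ereal_sup _; set Ig := ereal_sup _.
have fin (h : {nnsfun X >-> R}) : sintegral c h \is a fin_num.
  exact: content_sintegral_fin.
have hI (h : {nnsfun X >-> R}) : (forall x, (h x)%:E <= f x) ->
    sintegral c h + Ig <= \int[c]_x (f x + g x).
  move=> hf; rewrite addeC -leeBrDr//; apply: ge_ereal_sup => _ [k /= kg <-].
  rewrite leeBrDr// addeC -content_sintegralD//.
  apply: (@content_sintegral_le_integral _ (add_nnsfun h k)) => x.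
  by rewrite EFinD leeD.
(* Moving [Ig] across the inequality requires it to be finite; if it is infinite, [hI] at the zero
   function makes the right-hand side infinite as well. *)
have [Igfin|] := boolP (Ig \is a fin_num).
  rewrite -leeBrDr//; apply: ge_ereal_sup => _ [h /= hf <-].
  by rewrite leeBrDr//; exact: hI.
rewrite ge0_fin_numE -?leNgt ?leye_eq; last first.
  by apply: ereal_sup_ubound; exists nnsfun0 => //; rewrite content_sintegral_cst// mul0e.
move=> /eqP Igoo; have := hI nnsfun0 f0; rewrite Igoo.
by rewrite content_sintegral_cst// mul0e add0e leye_eq => /eqP ->; rewrite leey.
Qed.

Lemma content_le_integralZ f (r : R) : (0 <= r)%R -> (forall x, 0 <= f x) ->
  r%:E * \int[c]_x f x <= \int[c]_x (r%:E * f x).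
Proof.
move=> r0 f0; have [->|rneq0] := eqVneq r 0%R.
  by rewrite mul0e; apply: content_integral_ge0 => x; rewrite mul0e.
have rgt0 : (0 < r)%R by rewrite lt_neqAle eq_sym rneq0.
rewrite -lee_pdivlMl// (content_integralE f0).
apply: ge_ereal_sup => _ [h /= hf <-].
rewrite lee_pdivlMl// -content_sintegralZ//.
apply: (@content_sintegral_le_integral _ (scale_nnsfun h r0)) => x.
by rewrite EFinM lee_pmul2l.
Qed.

Lemma content_le_integral_sum (I : Type) (s : seq I) (r : I -> R) (f : I -> X -> \bar R) :
  (forall i, (0 <= r i)%R) -> (forall i x, 0 <= f i x) ->
  \sum_(i <- s) (r i)%:E * \int[c]_x f i x <=
  \int[c]_x (\sum_(i <- s) (r i)%:E * f i x).
Proof.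
move=> r0 f0; elim: s => [|i s IH].
  by rewrite big_nil; apply: content_integral_ge0 => x; rewrite big_nil.
rewrite big_cons [X in _ <= integral _ _ X](_ : _ = fun x => (r i)%:E * f i x +
    \sum_(j <- s) (r j)%:E * f j x); last by apply/funext => x; rewrite big_cons.
apply: (@le_trans _ _ (\int[c]_x ((r i)%:E * f i x) +
    \int[c]_x (\sum_(j <- s) (r j)%:E * f j x))).
  by apply: leeD => //; exact: content_le_integralZ.
apply: content_le_integralD => x; first by rewrite mule_ge0// lee_fin.
by apply: sume_ge0 => j _; rewrite mule_ge0// lee_fin.
Qed.

End content_integral.

(** * Uniform approximation by simple functions *)

Section uniform_approximation.
Context d (X : measurableType d) (R : realType).

(** With [M = N + 1], the function [h] is [f] rounded down to a multiple of [1/M]: it is [1/M] times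
    the number of [i < M] with [(i + 1)/M <= f x]. *)
Lemma nnsfun_uniform_approx (f : X -> \bar R) (N : nat) :
  measurable_fun [set: X] f -> (forall x, 0 <= f x <= 1) ->
  exists h : {nnsfun X >-> R},
    forall x, (h x)%:E <= f x <= (h x + N.+1%:R^-1)%:E.
Proof.
move=> mf f01.
pose A i := [set x | ((i.+1)%:R / N.+1%:R)%:E <= f x].
have mA i : measurable (A i).
  rewrite /A -[X in measurable X]setTI.
  by apply: emeasurable_fun_c_infty.
have N0 : (0 <= N.+1%:R^-1 :> R)%R by [].
pose h := sum_nnsfun (fun i => scale_nnsfun (indic_nnsfun R (mA i)) N0) N.+1.
exists h => x; rewrite /h sum_nnsfunE.
have [y fy y01] : exists2 y : R, f x = y%:E & (0 <= y <= 1)%R.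
  by have := f01 x; case: (f x) => [y y01| |]; [exists y|rewrite leye_eq andbF|].
have /andP[y0 y1] := y01.
pose t := Num.truncn (y * N.+1%:R)%R.
have yN0 : (0 <= y * N.+1%:R)%R by rewrite mulr_ge0.
have tN : (t <= N.+1)%N.
  rewrite -(@ler_nat R); apply: (@le_trans _ _ (y * N.+1%:R)%R).
    by rewrite /t truncn_le.
  by rewrite ler_piMl.
(* The level sets containing [x] are exactly those of index [i < t], and [t <= N + 1] because
   [y <= 1]. *)
rewrite (_ : (\sum_(i < N.+1) _)%R = t%:R / N.+1%:R)%R; last first.
  rewrite (eq_bigr (fun i : 'I_N.+1 => N.+1%:R^-1 * (i < t)%:R))%R; last first.
    move=> i _ /=; congr (_ * _)%R; rewrite mindicE; congr (_%:R)%R; congr nat_of_bool.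
    rewrite truncn_gt_nat; apply/idP/idP; rewrite inE /A /= fy lee_fin.
      by rewrite ler_pdivrMr.
    by rewrite ler_pdivrMr.
  rewrite -mulr_sumr mulrC; congr (_ * _)%R.
  rewrite -natr_sum; congr (_%:R)%R.
  rewrite -(big_mkord xpredT (fun i => nat_of_bool (i < t)%N)) (big_cat_nat (leq0n t) tN)//=.
  rewrite big_nat (eq_bigr (fun=> 1%N)); last by move=> i /andP[_ ->].
  rewrite -big_nat sum_nat_const_nat subn0 muln1 big_nat big1 ?addn0//.
  by move=> i /andP[ti _]; rewrite ltnNge ti.
have /andP[ty yt] := truncn_itv yN0.
rewrite fy !lee_fin ler_pdivrMr// ty /= -[X in (_ + X)%R]mul1r -mulrDl ler_pdivlMr// natr1.
by rewrite ltW.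
Qed.

End uniform_approximation.

Lemma lee_addinvn (R : realType) (a b K : \bar R) : K \is a fin_num -> 0 <= K ->
  (forall N, a <= b + (N.+1%:R^-1)%:E * K) -> a <= b.
Proof.
case: K => [K| |]//= _; rewrite lee_fin => K0 H.
apply/lee_addgt0Pr => e e0.
have [N NK] : exists N, (N.+1%:R^-1 * K <= e)%R.
  exists (Num.truncn (K / e)).
  by rewrite mulrC ler_pdivrMr// mulrC -ler_pdivrMr// ltW// truncnS_gt.
by apply: le_trans (H N) _; rewrite leeD2l// -EFinM lee_fin.
Qed.

(** * Linearity in the content, and mixtures of measures *)

Section content_integral_approx.
Context d (X : measurableType d) (R : realType).
Implicit Type c : {content set X -> \bar R}.

(** This takes the place of monotone convergence, which fails for contents: a uniform error [e]
    costs at most [e] times the total mass. *)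
Lemma content_integral_approx c (f : X -> \bar R) (h : {nnsfun X >-> R}) (e : R) :
  c setT \is a fin_num -> (0 <= e)%R ->
  (forall x, (h x)%:E <= f x <= (h x + e)%:E) ->
  sintegral c h <= \int[c]_x f x <= sintegral c h + e%:E * c setT.
Proof.
move=> cfin e0 hfe; apply/andP; split.
  by apply: content_sintegral_le_integral => // x; have /andP[] := hfe x.
rewrite -(content_sintegral_cst (NngNum e0))// -content_sintegralD//.
rewrite -(content_integral_nnsfun cfin (add_nnsfun h (cst_nnsfun X (NngNum e0)))).
apply: content_le_integral => // x; have /andP[hf fe] := hfe x => //.
by apply: le_trans hf; rewrite lee_fin.
Qed.

Lemma content_sintegralE c (h : {nnsfun X >-> R}) :
  sintegral c h = \sum_(y <- fset_set (range h)) y%:E * c (h @^-1` [set y]).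
Proof.
rewrite -fsbig_finite//= sintegralET (fsbig_widen (range h) setT)//= => y [_ Ny] /=.
by rewrite preimage10// measure0 mule0.
Qed.

Lemma sintegral_lin c c1 c2 (k : R) (h : {nnsfun X >-> R}) : (0 <= k)%R ->
  (forall E, measurable E -> c E = c1 E + k%:E * c2 E) ->
  sintegral c h = sintegral c1 h + k%:E * sintegral c2 h.
Proof.
move=> k0 cE; rewrite !content_sintegralE.
(* Negative [y] are harmless: their preimage under the nonnegative [h] is empty. *)
have ge0 (c0 : {content set X -> \bar R}) y : 0 <= y%:E * c0 (h @^-1` [set y]).
  have [y0|y0] := ltP y 0%R; first by rewrite preimage_nnfun0// measure0 mule0.
  by rewrite mule_ge0// lee_fin.
rewrite ge0_sume_distrr// -big_split; apply: eq_bigr => y _ /=.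
have [y0|y0] := ltP y 0%R.
  by rewrite preimage_nnfun0// !measure0 !mule0 adde0.
by rewrite cE// ge0_muleDr// ?mule_ge0// ?lee_fin// muleCA.
Qed.

(** The identity holds for simple functions. Replacing [f] by its approximation [h] costs at most
    [c setT / (N + 1)] on either side, since the errors for [c1] and [c2] combine in the same way as
    the masses do. *)
Lemma content_integral_lin c c1 c2 (k : R) (f : X -> \bar R) :
  c setT \is a fin_num -> c1 setT \is a fin_num -> c2 setT \is a fin_num ->
  (0 <= k)%R ->
  (forall E, measurable E -> c E = c1 E + k%:E * c2 E) ->
  measurable_fun [set: X] f -> (forall x, 0 <= f x <= 1) ->
  \int[c]_x f x = \int[c1]_x f x + k%:E * \int[c2]_x f x.
Proof.
move=> cf c1f c2f k0 cE mf f01.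
have fin1 := content_integral_fin c1f f01.
have fin2 := content_integral_fin c2f f01.
have eN0 N : (0 <= N.+1%:R^-1 :> R)%R by [].
apply/eqP; rewrite eq_le; apply/andP; split; apply: (lee_addinvn cf) => // N;
  have [h hf] := nnsfun_uniform_approx N mf f01;
  have /andP[hc ch] := content_integral_approx cf (eN0 N) hf;
  have /andP[hc1 ch1] := content_integral_approx c1f (eN0 N) hf;
  have /andP[hc2 ch2] := content_integral_approx c2f (eN0 N) hf.
  apply: le_trans ch _; rewrite leeD2r// (sintegral_lin _ k0 cE).
  by rewrite leeD// lee_wpmul2l// lee_fin.
apply: (@le_trans _ _ (sintegral c h + N.+1%:R^-1%:E * c setT)); last by rewrite leeD2r.
rewrite (sintegral_lin _ k0 cE) cE//.
have e0 := eN0 N; set e := (N.+1%:R^-1)%R in e0 ch1 ch2 *.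
have -> : e%:E * (c1 setT + k%:E * c2 setT) =
    e%:E * c1 setT + k%:E * (e%:E * c2 setT).
  by rewrite muleCA ge0_muleDr// mule_ge0// lee_fin.
rewrite addeACA leeD//.
have -> : k%:E * sintegral c2 h + k%:E * (e%:E * c2 setT) =
    k%:E * (sintegral c2 h + e%:E * c2 setT).
  by rewrite ge0_muleDr// ?content_sintegral_ge0// mule_ge0// lee_fin.
by rewrite lee_wpmul2l ?lee_fin.
Qed.

(** For a simple [h] below [f], expand its integral over the values of [h], move the finite sum
    inside the integral by superadditivity, and bound the inner integral of [h] by that of [f]. *)
Lemma content_integral_mixture_le c c' (K : X -> {measure set X -> \bar R})
    (f : X -> \bar R) :
  c setT \is a fin_num -> c' setT \is a fin_num ->
  (forall E, measurable E -> c' E = \int[c]_x K x E) ->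
  (forall x, 0 <= f x) ->
  \int[c']_x f x <= \int[c]_x \int[K x]_y f y.
Proof.
move=> cf c'f c'E f0; rewrite (content_integralE c'f f0).
apply: ge_ereal_sup => _ [h /= hf <-]; rewrite content_sintegralE.
(* The absolute value makes the coefficient nonnegative for every real [y], as
   [content_le_integral_sum] demands; it changes nothing on the range of [h]. *)
rewrite big_seq (eq_bigr (fun y => `|y|%:E * \int[c]_x K x (h @^-1` [set y]))); last first.
  move=> y; rewrite in_fset_set// inE => -[x _ <-].
  by rewrite c'E// ger0_norm.
rewrite -big_seq.
apply: le_trans (content_le_integral_sum _ _ _ _) _ => //.
apply: content_le_integral => // x.
  by apply: sume_ge0 => y _; rewrite mule_ge0// lee_fin.
rewrite ge0_integralTE//; apply: ereal_sup_ubound; exists h => //.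
rewrite content_sintegralE big_seq [RHS]big_seq; apply: eq_bigr => y.
by rewrite in_fset_set// inE => -[z _ <-]; rewrite ger0_norm.
Qed.

End content_integral_approx.

(** * The largest measure below a content *)

Section ca_part.
Context d (X : measurableType d) (R : realType).
Variable c : {content set X -> \bar R}.

Definition ca_part : set X -> \bar R := mu_ext c.

(** Each member of a cover splits along [E] into two measurable pieces, and finite additivity of [c]
    distributes its mass between a cover of [Y] inside [E] and one outside. *)
Lemma measurable_ca_part_caratheodory E : measurable E ->
  caratheodory_measurable ca_part E.
Proof.
move=> mE; apply: le_caratheodory_measurable => Y.
apply: le_ereal_inf_tmp => _ [B [mB YB] <-].
have mBE k : measurable (B k `&` E) by exact: measurableI.
have mBCE k : measurable (B k `&` ~` E) by apply: measurableI => //; exact: measurableC.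
rewrite (eq_eseriesr (g := fun k => c (B k `&` E) + c (B k `&` ~` E))); last first.
  move=> k _; rewrite -contentU//; first by rewrite -setIUr setUCr setIT.
  by rewrite setIACA setICr setI0.
rewrite nneseriesD//; apply: leeD; apply: ereal_inf_lbound.
  exists (fun k => B k `&` E) => //; split => // x [/YB [k _ Bkx] Ex].
  by exists k.
exists (fun k => B k `&` ~` E) => //; split => // x [/YB [k _ Bkx] Ex].
by exists k.
Qed.

Let ca_part0 : ca_part set0 = 0.
Proof. exact: outer_measure0. Qed.

Let ca_part_ge0 E : 0 <= ca_part E.
Proof. exact: outer_measure_ge0. Qed.

Let ca_part_sigma_additive : semi_sigma_additive ca_part.
Proof.
move=> F mF tF mUF; apply: caratheodory_measure_sigma_additive => //.
- by move=> i; exact: measurable_ca_part_caratheodory.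
- exact: measurable_ca_part_caratheodory.
Qed.

HB.instance Definition _ := isMeasure.Build d X R ca_part
  ca_part0 ca_part_ge0 ca_part_sigma_additive.

Lemma ca_part_le E : measurable E -> ca_part E <= c E.
Proof.
move=> mE; apply: ereal_inf_lbound; exists (fun k => if k is 0%N then E else set0).
  by split => [[|k]//|x Ex]; exists 0%N.
rewrite (nneseries_split _ 1%N)// big_mkord big_ord_recl/= big_ord0 adde0.
by rewrite eseries0 ?adde0// => -[].
Qed.

(** Countable subadditivity of [m] bounds [m E] by the total [c]-mass of any cover of [E]. *)
Lemma ca_part_max (m : {measure set X -> \bar R}) :
  (forall E, measurable E -> m E <= c E) ->
  forall E, measurable E -> m E <= ca_part E.
Proof.
move=> mc E mE; apply: le_ereal_inf_tmp => _ [B [mB EB] <-].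
apply: (@le_trans _ _ (\sum_(k <oo) m (B k))).
  exact: measure_sigma_subadditive.
by apply: lee_nneseries => // k _; exact: mc.
Qed.

End ca_part.

(** * Comparison of two contents *)

Section content_comparison.
Context d (X : measurableType d) (R : realType).
Implicit Type c : {content set X -> \bar R}.

Lemma content_integral_le_content c1 c2 (f : X -> \bar R) :
  c1 setT \is a fin_num -> c2 setT \is a fin_num ->
  (forall E, measurable E -> c1 E <= c2 E) -> (forall x, 0 <= f x) ->
  \int[c1]_x f x <= \int[c2]_x f x.
Proof.
move=> c1f c2f c12 f0; rewrite (content_integralE c1f f0).
apply: ge_ereal_sup => _ [h /= hf <-].
apply: le_trans (content_sintegral_le_integral c2f hf).
rewrite !content_sintegralE big_seq [leRHS]big_seq; apply: lee_sum => y.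
rewrite in_fset_set// inE => -[x _ <-].
by rewrite lee_wpmul2l ?lee_fin// c12.
Qed.

(** A strict inequality at [E] would have to be compensated at the complement of [E], where the
    order is the same. *)
Lemma content_le_eq c1 c2 : c2 setT \is a fin_num ->
  (forall E, measurable E -> c1 E <= c2 E) -> c1 setT = c2 setT ->
  forall E, measurable E -> c1 E = c2 E.
Proof.
move=> c2f c12 cT E mE; apply/eqP; rewrite eq_le c12//=.
have mCE := measurableC mE.
have TE (c : {content set X -> \bar R}) : c setT = c E + c (~` E).
  by rewrite -contentU ?setUv ?setICr.
have fE (c : {content set X -> \bar R}) F : c setT \is a fin_num -> measurable F ->
    c F \is a fin_num by exact: fin_content.
have : c2 E + c2 (~` E) <= c1 E + c2 (~` E).
  by rewrite -TE -cT (TE c1) leeD2l// c12.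
by rewrite leeD2rE// fE.
Qed.

End content_comparison.

(** * Stationary contents and their countably additive part *)

Section stationary_contents.
Context d (X : measurableType d) (R : realType).
Variable p : R.-pker X ~> X.
Implicit Type c : {content set X -> \bar R}.

Definition stationary (mu : set X -> \bar R) :=
  forall E, measurable E -> \int[mu]_x p x E = mu E.

Lemma kernel01 (K : R.-spker X ~> X) x E : measurable E -> 0 <= K x E <= 1.
Proof.
move=> mE; rewrite measure_ge0 (@le_trans _ _ (K x setT)) ?le_content//.
exact: sprob_kernel_le1.
Qed.

Section push.
Variable m : {measure set X -> \bar R}.

(** The image of [m] under the Markov operator; it is again a measure by monotone convergence. *)
Definition push (E : set X) : \bar R := \int[m]_x p x E.

Let push0 : push set0 = 0.
Proof. by rewrite /push integral0_eq// => x _; rewrite measure0. Qed.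

Let push_ge0 E : 0 <= push E. Proof. exact: integral_ge0. Qed.

Let push_sigma_additive : semi_sigma_additive push.
Proof.
move=> F mF tF mUF; rewrite [X in _ --> X](_ : _ =
    \int[m]_x (\sum_(n <oo) p x (F n))); last first.
  apply: eq_integral => x _.
  by apply/esym/cvg_lim => //; exact/measure_semi_sigma_additive.
apply/cvg_closeP; split.
  by apply: is_cvg_nneseries => n _ _; exact: integral_ge0.
by rewrite closeE// integral_nneseries// => n; exact: measurable_kernel.
Qed.

HB.instance Definition _ := isMeasure.Build d X R push
  push0 push_ge0 push_sigma_additive.

Lemma push_setT : push setT = m setT.
Proof.
rewrite /push (eq_integral (cst 1)) ?integral_cst ?mul1e// => x _.
by rewrite prob_kernel.
Qed.

End push.

Lemma ca_part_fin c : c setT \is a fin_num -> ca_part c setT \is a fin_num.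
Proof.
move=> cf; rewrite ge0_fin_numE// (le_lt_trans (ca_part_le c measurableT))//.
by rewrite -ge0_fin_numE.
Qed.

(** The push of [ca_part c] is a measure below the push of [c], which is [c]; by maximality it lies
    below [ca_part c]. Both have the same total mass, so they agree. *)
Lemma ca_part_stationary c : c setT \is a fin_num -> stationary c ->
  stationary (ca_part c).
Proof.
move=> cf cinv; have caf := ca_part_fin cf.
apply: (@content_le_eq _ _ _ (push (ca_part c)) (ca_part c)) => //.
  apply: ca_part_max => E mE; rewrite -cinv//.
  by apply: content_integral_le_content => // F mF; exact: ca_part_le.
exact: push_setT.
Qed.

Definition no_measure_below (mu : set X -> \bar R) :=
  forall m : {measure set X -> \bar R},
    (forall E, measurable E -> m E <= mu E) ->
    forall E, measurable E -> m E = 0.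

(** Take [q = (c - ca_part c) / k], where [k] is the missing mass. Linearity makes [q] stationary;
    and if [m] is a measure below [q], then [ca_part c + k m] is a measure below [c], so maximality
    gives [m = 0]. *)
Lemma exists_pure_stationary c : c setT \is a fin_num -> stationary c ->
  ~ semi_sigma_additive c ->
  exists q : {content set X -> \bar R},
    [/\ q setT = 1, stationary q & no_measure_below q].
Proof.
move=> cf cinv cnot; have caf := ca_part_fin cf.
have fE (c0 : {content set X -> \bar R}) F : c0 setT \is a fin_num -> measurable F ->
    c0 F \is a fin_num by exact: fin_content.
pose a E := fine (c E); pose b E := fine (ca_part c E).
have aE E : measurable E -> c E = (a E)%:E by move=> mE; rewrite fineK// fE.
have bE E : measurable E -> ca_part c E = (b E)%:E by move=> mE; rewrite fineK// fE.
have ba E : measurable E -> (b E <= a E)%R.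
  by move=> mE; rewrite -lee_fin -aE// -bE// ca_part_le.
(* With no missing mass, [ca_part c] would equal [c] and [c] would be countably additive. *)
have k0 : (0 < a setT - b setT)%R.
  rewrite subr_gt0 lt_neqAle ba// andbT; apply/eqP => ab; apply: cnot.
  have ecb : forall E, measurable E -> ca_part c E = c E.
    apply: (@content_le_eq _ _ _ (ca_part c) c) => //.
      by move=> E mE; exact: ca_part_le.
    by apply: etrans (bE _ measurableT) _; rewrite ab -aE.
  move=> F mF tF mUF; rewrite -ecb// (_ : (fun n => _) =
      (fun n => \sum_(0 <= i < n) ca_part c (F i))).
    exact: measure_semi_sigma_additive.
  by apply/funext => n; apply: eq_bigr => i _; rewrite ecb.
set k := (a setT - b setT)%R in k0.
pose f E := ((a E - b E) / k)%R.
have faf : nonneg_additive f.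
  split=> [E mE|A B mA mB AB]; first by rewrite divr_ge0 ?subr_ge0 ?ba// ltW.
  have fin_fineD (c0 : {content set X -> \bar R}) : c0 setT \is a fin_num ->
      fine (c0 (A `|` B)) = (fine (c0 A) + fine (c0 B))%R.
    by move=> c0f; rewrite contentU// fineD// fE.
  rewrite /f {1}/a {1}/b fin_fineD// (fin_fineD (ca_part c))// -/(a A) -/(a B).
  by rewrite -/(b A) -/(b B); field; rewrite gt_eqF.
pose q : {content set X -> \bar R} := additive_content faf.
have qE E : measurable E -> q E = (f E)%:E by exact: additive_contentE.
have qT : q setT = 1.
  by rewrite qE// /f divff// gt_eqF.
have cE E : measurable E -> c E = ca_part c E + k%:E * q E.
  move=> mE; rewrite qE// aE// bE// -EFinM -EFinD; congr EFin.
  by rewrite /f; field; rewrite gt_eqF.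
exists q; split => //.
  move=> E mE.
  have := @content_integral_lin _ _ _ c (ca_part c) q k (fun x => p x E) cf caf _ (ltW k0) cE
    (measurable_kernel p E mE) (fun x => kernel01 p x mE).
  rewrite qT => /(_ isT); rewrite cinv// (ca_part_stationary cf cinv mE) cE//.
  have qf : \int[q]_x p x E \is a fin_num.
    by apply: content_integral_fin => [|x]; rewrite ?qT//; exact: kernel01.
  have qEf : q E \is a fin_num by rewrite qE.
  move: qf qEf; case: (\int[q]_x p x E) => // u _; case: (q E) => // v _.
  rewrite bE// -!EFinM -!EFinD => -[/addrI/mulfI -> //].
  by rewrite gt_eqF.
move=> m mq E mE.
have k0' : (0 <= k)%R by exact: ltW.
pose m1 : {measure set X -> \bar R} :=
  measure_add (ca_part c) (mscale (NngNum k0') m).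
have m1E F : m1 F = ca_part c F + k%:E * m F by exact: measure_addE.
have mca : ca_part c E + k%:E * m E <= ca_part c E.
  rewrite -m1E; apply: ca_part_max => // F mF; rewrite m1E cE// leeD2l//.
  by rewrite lee_pmul2l// mq.
have caEf : ca_part c E \is a fin_num by exact: (fE (ca_part c)).
have kmE : k%:E * m E <= 0.
  move: caEf mca; generalize (ca_part c E) (k%:E * m E) => u v uf.
  by rewrite -[leRHS]adde0 leeD2lE.
apply/eqP; rewrite eq_le measure_ge0 andbT.
by move: kmE; rewrite pmule_rle0.
Qed.

End stationary_contents.

(** * Iterated kernels, and the Doeblin condition against pure contents *)

Section kernel_iterates.
Context d (X : measurableType d) (R : realType).
Variable p : R.-pker X ~> X.

(** The index is shifted: [kernel_iter n] is [p^(n+1)]. Composition of kernels supplies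
    measurability in the starting point. *)
Fixpoint kernel_iter (n : nat) : R.-spker X ~> X :=
  if n is n'.+1 then mkcomp_noparam p (kernel_iter n') else p.

Lemma kernel_iterS n x E :
  kernel_iter n.+1 x E = \int[p x]_y kernel_iter n y E.
Proof. by []. Qed.

Lemma transition_iterE n x E : transition_iter p n.+1 x E = kernel_iter n x E.
Proof.
elim: n x => [//|n IH] x; rewrite kernel_iterS.
by apply: eq_integral => y _; rewrite -IH.
Qed.

Lemma measurable_kernel_iter n E : measurable E ->
  measurable_fun [set: X] (fun x => kernel_iter n x E).
Proof. by move=> mE; exact: measurable_kernel. Qed.

(** By induction, viewing the stationary [c] as the mixture of the [p x] under [c] itself. *)
Lemma stationary_le_iter (c : {content set X -> \bar R}) n E :
  c setT \is a fin_num -> stationary p c -> measurable E ->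
  c E <= \int[c]_x kernel_iter n x E.
Proof.
move=> cf cinv mE; elim: n => [|n IH]; first by rewrite cinv.
apply: (le_trans IH); apply: content_integral_mixture_le => //.
by move=> F mF; rewrite cinv.
Qed.

(** Since [ca_part q] vanishes, the whole space has a countable cover of total [q]-mass below [e].
    Finite unions of its members keep [q]-mass below [e], while their complements decrease to the
    empty set, so some complement is small for [phi]. *)
Lemma no_measure_below_concentration (q : {content set X -> \bar R})
    (phi : {finite_measure set X -> \bar R}) (e : R) :
  q setT \is a fin_num -> no_measure_below q -> (0 < e)%R ->
  exists E, [/\ measurable E, phi E <= e%:E & q (~` E) < e%:E].
Proof.
move=> qf qpure e0.
have : ca_part q setT < e%:E.
  by rewrite (qpure (ca_part q)) ?lte_fin// => E mE; exact: ca_part_le.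
move=> /ereal_inf_lt[_ [B [mB TB] <-] Be].
pose U n := \bigcup_(k < n) B k.
have mU n : measurable (U n) by exact: fin_bigcup_measurable.
have ncU : nonincreasing_seq (fun n => ~` U n).
  move=> m n mn; apply/subsetPset; apply: subsetC => x [k /= km Bkx].
  by exists k => //=; exact: leq_trans mn.
have UT : \bigcap_n (~` U n) = set0.
  apply/seteqP; split=> // x Ux; have [k _ Bkx] := TB x Logic.I.
  by apply: (Ux k.+1) => //; exists k => /=.
have : phi (~` U n) @[n --> \oo] --> 0.
  rewrite -(measure0 phi) -UT; apply: nonincreasing_cvg_mu => //.
  - by rewrite -ge0_fin_numE// fin_num_measure//; exact: measurableC.
  - by move=> n; exact: measurableC.
  - by rewrite UT.
have phinc : nonincreasing_seq (fun n => phi (~` U n)).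
  move=> m n mn; apply: le_measure; rewrite ?inE; try exact: measurableC.
  exact/subsetPset/ncU.
move/cvg_lim => /(_ (@ereal_hausdorff R)).
rewrite (cvg_lim (@ereal_hausdorff R) (ereal_nonincreasing_cvgn phinc)) => inf0.
have : ereal_inf (range (fun n => phi (~` U n))) < e%:E by rewrite inf0 lte_fin.
move=> /ereal_inf_lt[_ [n _ <-] phie].
exists (~` U n); split; [exact: measurableC|exact: ltW|].
rewrite setCK; apply: le_lt_trans Be.
rewrite /U bigcup_mkord; apply: le_trans (Boole_inequality q (fun i _ => mB i)) _.
rewrite -(big_mkord xpredT (fun k => q (B k))).
exact: nneseries_lim_ge.
Qed.

Lemma doeblin_no_pure_stationary (q : {content set X -> \bar R}) :
  q setT = 1 -> stationary p q -> no_measure_below q -> ~ doeblin_condition p.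
Proof.
move=> qT qinv qpure [phi [e [k [e0 k1 De]]]].
(* The exponent is positive, so it becomes [k + 1], matching [kernel_iter k]. *)
case: k k1 De => // k _ De.
have qf : q setT \is a fin_num by rewrite qT.
have [E [mE phiE qE]] := no_measure_below_concentration phi qf qpure e0.
have qEe : q E <= (1 - e)%:E.
  apply: (le_trans (stationary_le_iter k qf qinv mE)).
  rewrite -[leRHS]mule1 -qT; apply: content_integral_le_cst => // x.
  by rewrite measure_ge0 -transition_iterE De.
have : q setT < (1 - e)%:E + e%:E.
  rewrite -(setUv E) contentU// ?setICr//; last exact: measurableC.
  by apply: lee_ltD => //; exact: fin_content.
by rewrite -EFinD subrK qT ltxx.
Qed.

End kernel_iterates.

(** * Limits along an ultrafilter *)

Section ultralimit.
Context (R : realType) (U : set_system nat).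
Hypothesis UU : UltraFilter U.

Lemma ultra_cvg01 (u : nat -> R) : (forall n, 0 <= u n <= 1)%R ->
  exists2 l : R, (0 <= l <= 1)%R & u n @[n --> U] --> l.
Proof.
move=> u01; have := @segment_compact R 0%R 1%R.
have FU : (u @ U) `[0%R, 1%R]%classic.
  by apply: (@filterS _ U _ setT); [move=> n _; rewrite /= in_itv/=; exact: u01|exact: filterT].
move=> /(_ (u @ U) _ FU)[l [l01 ul]].
exists l; first by move: l01; rewrite /= in_itv.
(* An ultrafilter converges to its cluster point: otherwise it would contain the complement of a
   neighbourhood. *)
move=> B lB; have [//|UnB] := in_ultra_setVsetC (u @^-1` B) UU.
have [x [/= nBx Bx]] : (~` B) `&` B !=set0 by apply: ul.
by [].
Qed.

Lemma ultra_cvg_seq (u : nat -> R) (l : R) : \oo `<=` U ->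
  u n @[n --> \oo] --> l -> u n @[n --> U] --> l.
Proof. by move=> ooU ul B /ul; exact: ooU. Qed.

End ultralimit.

(** * Stationary limits of asymptotically stationary sequences *)

Section asymptotically_stationary.
Context d (X : measurableType d) (R : realType).
Variable p : R.-pker X ~> X.
Variable nu : nat -> {content set X -> \bar R}.
Hypothesis nuT : forall n, nu n setT = 1.
Hypothesis nu_stationary : forall E, measurable E ->
  (fine (\int[nu n]_x p x E) - fine (nu n E))%R @[n --> \oo] --> (0 : R)%R.

Let nuf n : nu n setT \is a fin_num. Proof. by rewrite nuT. Qed.

Let fine_nu01 n E : measurable E -> (0 <= fine (nu n E) <= 1)%R.
Proof.
move=> mE; have nuE : nu n E \is a fin_num by exact: fin_content.
rewrite fine_ge0//= -lee_fin fineK// -(nuT n).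
by apply: le_content.
Qed.

(** The content [c] is the setwise limit along an ultrafilter finer than [\oo]. Finite additivity
    survives the limit, and so do integrals of bounded measurable functions, because the simple
    approximation is uniform in [n]. The last clause says that ordinary limits are retained. *)
Lemma stationary_limit : exists c : {content set X -> \bar R},
  [/\ c setT = 1, stationary p c &
    forall E (l : R), measurable E -> fine (nu n E) @[n --> \oo] --> l ->
      c E = l%:E].
Proof.
have [U [UU ooU]] := ultraFilterLemma (eventually_filter : ProperFilter \oo).
have : forall E, exists l : R, measurable E ->
    (0 <= l <= 1)%R /\ fine (nu n E) @[n --> U] --> l.
  move=> E; have [mE|nE] := pselect (measurable E); last by exists 0%R.
  have [l l01 ul] := ultra_cvg01 UU (fun n => fine_nu01 n mE).
  by exists l.
move=> /choice[L HL].
have L01 E (mE : measurable E) := (HL E mE).1.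
have UL E (mE : measurable E) := (HL E mE).2.
have uniqU (u : nat -> R) (a b : R) : u n @[n --> U] --> a -> u n @[n --> U] --> b -> a = b.
  exact: (@cvg_unique _ (@Rhausdorff R) (u @ U)%classic _ a b).
have ooL E (l : R) : measurable E -> fine (nu n E) @[n --> \oo] --> l -> L E = l.
  by move=> mE /(ultra_cvg_seq ooU); exact: uniqU (UL E mE).
have LA : nonneg_additive L.
  split=> [E mE|A B mA mB AB]; first by have /andP[] := L01 E mE.
  apply: (uniqU _ _ _ (UL _ (measurableU _ _ mA mB))).
  rewrite (_ : (fun n => _) = (fun n => fine (nu n A) + fine (nu n B)))%R.
    by apply: cvgD; exact: UL.
  by apply/funext => n; rewrite contentU// fineD//; exact: fin_content.
pose c : {content set X -> \bar R} := additive_content LA.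
have cE E : measurable E -> c E = (L E)%:E by exact: additive_contentE.
have LT : L setT = 1%R.
  apply: ooL => //; rewrite (_ : (fun n => _) = fun=> 1%R); first exact: cvg_cst.
  by apply/funext => n; rewrite nuT.
have cT : c setT = 1 by rewrite cE// LT.
have cf : c setT \is a fin_num by rewrite cT.
exists c; split => //; last by move=> E l mE nul; rewrite cE// (ooL E l).
move=> E mE; rewrite cE//.
have f01 x := kernel01 p x mE.
have mf := measurable_kernel p E mE.
(* For a fixed simple function the integral is a finite sum of values of the content, so it passes
   to the limit. *)
have sU (h : {nnsfun X >-> R}) :
    fine (sintegral (nu n) h) @[n --> U] --> fine (sintegral c h).
  have sE (c0 : {content set X -> \bar R}) : c0 setT \is a fin_num ->
      fine (sintegral c0 h) =
      (\sum_(y <- fset_set (range h)) y * fine (c0 (h @^-1` [set y])))%R.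
    move=> c0f; rewrite content_sintegralE.
    rewrite (eq_bigr (fun y => (y * fine (c0 (h @^-1` [set y])))%:E)) ?sumEFin//.
    by move=> y _; rewrite EFinM fineK//; exact: fin_content.
  rewrite sE// (_ : (fun n => _) = fun n =>
      (\sum_(y <- fset_set (range h)) y * fine (nu n (h @^-1` [set y])))%R); last first.
    by apply/funext => n; rewrite sE.
  apply: cvg_big => [|y _]; first exact: add_continuous.
  by apply: cvgMr; rewrite cE//; exact: UL.
have IU : fine (\int[nu n]_x p x E) @[n --> U] --> L E.
  rewrite (_ : (fun n => _) = fun n => ((fine (\int[nu n]_x p x E) - fine (nu n E)) +
     fine (nu n E))%R); last by apply/funext => n; rewrite subrK.
  rewrite -[L E]add0r; apply: cvgD; last exact: UL.
  exact/(ultra_cvg_seq ooU)/nu_stationary.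
(* Here [s] is the integral of the approximating simple function against [c]. It is within [1/(N+1)]
   of the integral of [p(., E)], and also of [L E], by passing to the limit in the same bounds for
   [nu n]. *)
have approx N : exists s : R, [/\ s%:E <= \int[c]_x p x E <= s%:E + N.+1%:R^-1%:E,
    (s <= L E)%R & (L E <= s + N.+1%:R^-1)%R].
  have [h hf] := nnsfun_uniform_approx N mf f01.
  exists (fine (sintegral c h)).
  have e0 : (0 <= N.+1%:R^-1 :> R)%R by [].
  rewrite fineK ?content_sintegral_fin//.
  have A (c0 : {content set X -> \bar R}) : c0 setT = 1 ->
      sintegral c0 h <= \int[c0]_x p x E <= sintegral c0 h + N.+1%:R^-1%:E.
    move=> c0T; rewrite -[X in _ + X]mule1 -c0T.
    by apply: content_integral_approx => //; rewrite c0T.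
  split.
  - exact: A.
  - apply: (ler_cvg_to (sU h) IU); apply: nearW => n.
    have /andP[+ _] := A (nu n) (nuT n).
    by apply: fine_le; [exact: content_sintegral_fin|exact: content_integral_fin].
  - have sUe : (fine (sintegral (nu n) h) + N.+1%:R^-1)%R @[n --> U] -->
        (fine (sintegral c h) + N.+1%:R^-1)%R by apply: cvgD => //; exact: cvg_cst.
    apply: (ler_cvg_to IU sUe); apply: nearW => n.
    have /andP[_] := A (nu n) (nuT n).
    have sf := content_sintegral_fin h (nuf n).
    have If := content_integral_fin (nuf n) f01.
    by rewrite -lee_fin EFinD !fineK.
apply/eqP; rewrite eq_le; apply/andP; split;
    apply: (@lee_addinvn _ _ _ 1) => // N; rewrite mule1;
    have [s [/andP[sI Is] sL Ls]] := approx N.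
  by apply: le_trans Is _; rewrite leeD2r// lee_fin.
by apply: (@le_trans _ _ (s + N.+1%:R^-1)%:E); rewrite ?lee_fin// EFinD leeD2r.
Qed.

End asymptotically_stationary.

(** * Integrals against mixtures, and level sets at height one half *)

Section kernel_integrals.
Context d (X : measurableType d) (R : realType).

(** Seen as a constant finite kernel, [m] can be composed with [K]; the composition agrees with
    [m'], and the integral formula for composed kernels applies. *)
Lemma integral_mixture (m m' : {measure set X -> \bar R}) (K : R.-spker X ~> X)
    (f : X -> \bar R) :
  m setT \is a fin_num ->
  (forall E, measurable E -> m' E = \int[m]_x K x E) ->
  (forall x, 0 <= f x) -> measurable_fun [set: X] f ->
  \int[m']_x f x = \int[m]_x \int[K x]_y f y.
Proof.
move=> mfin m'E f0 mf.
pose k (_ : X) : {measure set X -> \bar R} := m.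
have mk U : measurable U -> measurable_fun [set: X] (k ^~ U).
  by move=> mU; exact: measurable_cst.
have kub : measure_fam_uub k.
  exists (fine (m setT) + 1)%R => x; rewrite /k EFinD fineK//.
  by rewrite lteDl// lte_fin.
pose k1 := isKernel.Build _ _ _ _ _ k mk.
pose k2 : R.-ker X ~> X := HB.pack k k1.
pose k3 := Kernel_isFinite.Build _ _ _ _ _ k2 kub.
pose k4 : R.-fker X ~> X := HB.pack k k1 k3.
rewrite (eq_measure_integral (kcomp k4 (kernel.kernel_snd K) point)).
  exact: (integral_kcomp k4 (kernel.kernel_snd K)).
by move=> A mA _; rewrite m'E.
Qed.

(** Integrate the pointwise bound of [f] by [1/2] plus half the indicator of the level set. *)
Lemma half_level_ge (m : {measure set X -> \bar R}) (f : X -> \bar R) (e : R) :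
  m setT <= 1 -> (forall x, 0 <= f x <= 1) -> measurable_fun [set: X] f ->
  (1 - e)%:E <= \int[m]_x f x ->
  (1 - 2 * e)%:E <= m [set x | (2^-1)%:E < f x].
Proof.
move=> m1 f01 mf fe; set B := [set x | _].
have mB : measurable B by rewrite -[B]setTI; exact: emeasurable_fun_o_infty.
have mBfin : m B \is a fin_num.
  by apply: (@fin_content _ _ _ m) => //; rewrite ge0_fin_numE// (le_lt_trans m1) ?ltry.
have h0 : (0 <= 2^-1 :> R)%R by [].
have : \int[m]_x f x <= \int[m]_x ((2^-1)%:E + (2^-1)%:E * (\1_B x)%:E).
  apply: ge0_le_integral => //.
  - by move=> x _; have /andP[] := f01 x.
  - apply: emeasurable_funD => //; apply: measurable_funeM.
    exact/measurable_EFinP/measurable_indic.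
  - move=> x _; rewrite indicE; have [xB|xB] := boolP (x \in B).
      have /andP[_ /le_trans] := f01 x; apply.
      by rewrite mule1 -EFinD lee_fin; lra.
    rewrite mule0 adde0 leNgt; apply/negP => xb.
    by move: xB; rewrite notin_setE; apply.
rewrite ge0_integralD//; last first.
  by apply: measurable_funeM; exact/measurable_EFinP/measurable_indic.
rewrite integral_cst// ge0_integralZl//; last first.
  by apply/measurable_EFinP/measurable_indic.
rewrite integral_indic// setIT => fB.
have : (1 - e)%:E <= (2^-1)%:E * 1 + (2^-1)%:E * m B.
  by apply: le_trans fe _; apply: le_trans fB _; rewrite leeD2r// lee_wpmul2l.
rewrite -(fineK mBfin) mule1 -EFinM -EFinD !lee_fin => ?; lra.
Qed.

(** Markov's inequality at height [1/2]. *)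
Lemma half_level_le (m : {measure set X -> \bar R}) (f : X -> \bar R) :
  (forall x, 0 <= f x) -> measurable_fun [set: X] f ->
  m [set x | (2^-1)%:E < f x] <= 2%:E * \int[m]_x f x.
Proof.
move=> f0 mf; set B := [set x | _].
have mB : measurable B by rewrite -[B]setTI; exact: emeasurable_fun_o_infty.
have mI : measurable_fun [set: X] (fun x => (\1_B x)%:E : \bar R).
  exact/measurable_EFinP/measurable_indic.
have H : (2^-1)%:E * m B <= \int[m]_x f x.
  have -> : m B = \int[m]_x (\1_B x)%:E by rewrite integral_indic// setIT.
  rewrite -ge0_integralZl//; apply: ge0_le_integral => //.
  - exact: measurable_funeM.
  - move=> x _; rewrite indicE; have [xB|xB] := boolP (x \in B).
      by rewrite mule1; apply: ltW; move: xB; rewrite inE.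
    by rewrite mule0.
have -> : m B = 2%:E * ((2^-1)%:E * m B) by rewrite muleA -EFinM divff// mul1e.
by apply: lee_wpmul2l => //; rewrite lee_fin.
Qed.

End kernel_integrals.

(** * Chapman-Kolmogorov equation and Cesaro means *)

Section iterates_of_stationary.
Context d (X : measurableType d) (R : realType).
Variable p : R.-pker X ~> X.

Lemma kernel_iter_setT n x : kernel_iter p n x setT = 1.
Proof.
elim: n x => [|n IH] x; first exact: prob_kernel.
rewrite kernel_iterS (eq_integral (cst 1)) ?integral_cst ?mul1e ?prob_kernel//.
Qed.

Lemma kernel_iter_fin n x E : measurable E -> kernel_iter p n x E \is a fin_num.
Proof.
move=> mE; have fT : kernel_iter p n x setT \is a fin_num.
  by rewrite kernel_iter_setT.
exact: fin_content.
Qed.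

Lemma integral_kernel_iter i x (f : X -> \bar R) :
  (forall y, 0 <= f y) -> measurable_fun [set: X] f ->
  \int[kernel_iter p i.+1 x]_y f y = \int[p x]_z \int[kernel_iter p i z]_y f y.
Proof.
by move=> f0 mf; apply: integral_mixture => //; rewrite prob_kernel.
Qed.

(** With the shifted index, the exponents [i + 1] and [j + 1] add up to the exponent of index
    [(i + j).+1]. *)
Lemma chapman_kolmogorov i j x E : measurable E ->
  kernel_iter p (i + j).+1 x E = \int[kernel_iter p i x]_y kernel_iter p j y E.
Proof.
move=> mE; elim: i x => [//|i IH] x.
rewrite addSn kernel_iterS integral_kernel_iter//; last exact: measurable_kernel_iter.
by apply: eq_integral => y _; exact: IH.
Qed.

Lemma stationary_iter (m : {measure set X -> \bar R}) n E :
  m setT \is a fin_num -> stationary p m -> measurable E ->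
  \int[m]_x kernel_iter p n x E = m E.
Proof.
move=> mf ms mE; elim: n => [|n IH]; first exact: ms.
rewrite -[RHS]IH; apply/esym; apply: integral_mixture => //.
  by move=> F mF; rewrite ms.
exact: measurable_kernel_iter.
Qed.

Lemma cesaro_weight_ge0 (N : nat) : (0 <= N.+1%:R^-1 :> R)%R. Proof. by []. Qed.

Definition cesaro_measure (x : X) (N : nat) : {measure set X -> \bar R} :=
  mscale (NngNum (cesaro_weight_ge0 N)) (msum (fun i => kernel_iter p i x) N.+1).

Lemma cesaroE x N E : measurable E ->
  cesaro_measure x N E = (N.+1%:R^-1 * \sum_(i < N.+1) fine (kernel_iter p i x E))%:E.
Proof.
move=> mE; rewrite EFinM -sumEFin.
rewrite (eq_bigr (fun i : 'I_N.+1 => kernel_iter p i x E))//.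
by move=> i _; rewrite fineK// kernel_iter_fin.
Qed.

Lemma cesaro_setT x N : cesaro_measure x N setT = 1.
Proof.
rewrite cesaroE// (eq_bigr (fun=> 1%R)) => [|i _]; last by rewrite kernel_iter_setT.
by rewrite sumr_const card_ord mulVf.
Qed.

(** The difference telescopes to two numbers of [[0, 1]], subtracted and divided by [N + 1]. *)
Lemma cesaro_defect x N E : measurable E ->
  (`|fine (\int[cesaro_measure x N]_y p y E) - fine (cesaro_measure x N E)| <= N.+1%:R^-1)%R.
Proof.
move=> mE; have mpE := measurable_kernel p E mE.
have -> : \int[cesaro_measure x N]_y p y E =
    (N.+1%:R^-1 * \sum_(i < N.+1) fine (kernel_iter p i.+1 x E))%:E.
  rewrite ge0_integral_mscale// ge0_integral_measure_sum// EFinM -sumEFin.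
  congr (_ * _); apply: eq_bigr => i _; rewrite fineK ?kernel_iter_fin//.
  by have := chapman_kolmogorov i 0 x mE; rewrite addn0 => ->.
rewrite cesaroE//= -mulrBr -sumrB.
rewrite -(big_mkord xpredT (fun i =>
   fine (kernel_iter p i.+1 x E) - fine (kernel_iter p i x E)))%R.
rewrite telescope_sumr// normrM ger0_norm// ler_piMr//.
have b01 i : (0 <= fine (kernel_iter p i x E) <= 1)%R.
  rewrite fine_ge0//= -lee_fin fineK ?kernel_iter_fin//.
  by have /andP[] := kernel01 (kernel_iter p i) x mE.
have /andP[? ?] := b01 N.+1; have /andP[? ?] := b01 0%N.
by rewrite ler_norml; apply/andP; split; lra.
Qed.

End iterates_of_stationary.

(** * Repackaging measures of finite mass and countably additive contents *)

Section finite_measure_of.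
Context d (X : measurableType d) (R : realType).
Variable m : {measure set X -> \bar R}.
Hypothesis mfin : m setT \is a fin_num.

Definition finite_measure_of & m setT \is a fin_num : set X -> \bar R := m.

HB.instance Definition _ := Measure.on (finite_measure_of mfin).

Let finite_measure_of_fin : fin_num_fun (finite_measure_of mfin).
Proof. by move=> E mE; exact: (@fin_content _ _ _ m). Qed.

HB.instance Definition _ := Measure_isFinite.Build d X R (finite_measure_of mfin)
  finite_measure_of_fin.

End finite_measure_of.

Section measure_of_content.
Context d (X : measurableType d) (R : realType).

Lemma measure_of_content (c : {content set X -> \bar R}) :
  semi_sigma_additive c ->
  exists m : {measure set X -> \bar R}, forall E, m E = c E.
Proof.
move=> cs; pose b := isMeasure.Build d X R (c : set X -> \bar R) (measure0 c) (measure_ge0 c) cs.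
pose m : {measure set X -> \bar R} := HB.pack (c : set X -> \bar R) b.
by exists m.
Qed.

End measure_of_content.

(** * A stationary probability singular to a given stationary measure *)

Section singular_stationary.
Context d (X : measurableType d) (R : realType).
Variable p : R.-pker X ~> X.
Hypothesis stationary_ca : forall c : {content set X -> \bar R},
  c setT = 1 -> stationary p c -> semi_sigma_additive c.
Hypothesis not_doeblin : ~ doeblin_condition p.

(** Chosen so that [n + 1] level sets, each of [phi]-mass at most [2 * eps n], have total mass at
    most [2^-(n+1)]. *)
Let eps (n : nat) : R := (2 * n.+1%:R * 2 ^+ n.+1)^-1.

Let eps_gt0 n : (0 < eps n)%R.
Proof. by rewrite /eps invr_gt0 !mulr_gt0// exprn_gt0. Qed.

Lemma stationary_limit_measure (nu : nat -> {content set X -> \bar R}) :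
  (forall n, nu n setT = 1) ->
  (forall E, measurable E ->
    (fine (\int[nu n]_x p x E) - fine (nu n E))%R @[n --> \oo] --> (0 : R)%R) ->
  exists m : {measure set X -> \bar R}, [/\ m setT = 1, stationary p m &
    forall E (l : R), measurable E -> fine (nu n E) @[n --> \oo] --> l ->
      m E = l%:E].
Proof.
move=> nuT nus; have [c [cT cs cl]] := stationary_limit nuT nus.
have [m mE] := measure_of_content (stationary_ca cT cs).
exists m; split; [by rewrite mE| |by move=> E l mE' /cl; rewrite mE; exact].
move=> E mE'; rewrite mE -cs//; apply: eq_integral_on_measurable => F _.
exact: mE.
Qed.

(* [p^(n+2)(x, E)] is the integral of [p^(j+1)(., E)] against [p^(i+1)(x, .)]
   when [i + j = n]; being close to 1, it forces every [p^(i+1)(x, .)] to charge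
   the set [G] of points where some [p^(j+1)(., E)] exceeds 1/2. *)
Lemma doeblin_violation (phi : {measure set X -> \bar R}) n :
  phi setT \is a fin_num -> stationary p phi ->
  exists (G : set X) (x : X), [/\ measurable G,
    phi G <= (2 ^+ n.+1)^-1%:E & (1 - n.+1%:R^-1)%:E <= cesaro_measure p x n G].
Proof.
move=> phif phis.
(* The Doeblin condition fails for [phi], [eps n] and the exponent [n + 2], which is index
   [n.+1]. *)
have [E [x [mE phiE xE]]] : exists E x, [/\ measurable E, phi E <= (eps n)%:E &
    (1 - eps n)%:E < kernel_iter p n.+1 x E].
  apply: contrapT => H; apply: not_doeblin.
  exists (finite_measure_of phif), (eps n), n.+2; split => // E mE phiE x.
  rewrite transition_iterE leNgt; apply/negP => xE; apply: H.
  by exists E, x.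
pose B j := [set y | (2^-1)%:E < kernel_iter p j y E].
have mB j : measurable (B j).
  rewrite -[B j]setTI; apply: emeasurable_fun_o_infty => //.
  exact: measurable_kernel_iter.
pose G := \big[setU/set0]_(j < n.+1) B j.
have mG : measurable G by apply: bigsetU_measurable => j _.
have eE : (2 * eps n * n.+1%:R = (2 ^+ n.+1)^-1)%R.
  have : (2 ^+ n.+1 : R)%R != 0%R by rewrite expf_neq0.
  have : (n.+1%:R : R)%R != 0%R by [].
  rewrite /eps; move: (n.+1%:R)%R (2 ^+ n.+1)%R => N P N0 P0.
  by field; rewrite N0 P0.
exists G, x; split => //.
  (* Union bound; by Markov's inequality and stationarity, each [phi (B j)] is at most twice
     [phi E]. *)
  apply: le_trans (Boole_inequality phi (fun i _ => mB i)) _.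
  apply: (@le_trans _ _ (\sum_(j < n.+1) (2 * eps n)%:E)).
    apply: lee_sum => j _; apply: le_trans (half_level_le _ _ _) _ => //.
      exact: measurable_kernel_iter.
    by rewrite (stationary_iter _ phif phis mE) EFinM lee_wpmul2l// lee_fin.
  by rewrite sumEFin sumr_const card_ord -[(2 * eps n *+ _)%R]mulr_natr eE.
rewrite cesaroE// lee_fin mulrC ler_pdivlMr//.
(* Every term of the average is at least [1 - 2 * eps n], and [2 * eps n <= 1/(n+1)] because
   [2^-(n+1) <= 1]. *)
apply: (@le_trans _ _ (\sum_(i < n.+1) (1 - 2 * eps n)))%R.
  rewrite sumr_const card_ord -[leRHS]mulr_natr ler_pM2r//.
  rewrite lerD2l lerN2 -(@ler_pM2r _ n.+1%:R)// eE mulVf//.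
  by rewrite invf_le1 ?exprn_gt0// exprn_ege1// ler1n.
apply: ler_sum => i _.
have ni : (n - i + i)%N = n by rewrite subnK// -ltnS.
rewrite -lee_fin fineK ?kernel_iter_fin//.
(* The level set paired with [i] has index [n - i], so that Chapman-Kolmogorov returns
   [p^(n+2)(x, E)]. *)
apply: (@le_trans _ _ (kernel_iter p i x (B (n - i)%N))).
  apply: half_level_ge.
  - by rewrite kernel_iter_setT.
  - by move=> y; exact: kernel01.
  - exact: measurable_kernel_iter.
  - by rewrite -chapman_kolmogorov// addnC ni ltW.
apply: le_content => //; rewrite /G -bigcup_mkord => y By.
by exists (n - i)%N => //=; rewrite ltnS leq_subr.
Qed.

(** Here [H] is the limsup of the sets [G n]: it is [phi]-null by Borel-Cantelli. Each tail union
    has [mu]-mass 1, as it contains [G k] for all large [k]; continuity from above then gives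
    [mu H = 1], which relies on the limit being a measure. *)
Lemma singular_stationary (phi : {measure set X -> \bar R}) :
  phi setT \is a fin_num -> stationary p phi ->
  exists (mu : {measure set X -> \bar R}) (H : set X),
    [/\ mu setT = 1, stationary p mu, measurable H, phi H = 0 & mu H = 1].
Proof.
move=> phif phis.
have : forall n, exists Gx : set X * X, [/\ measurable Gx.1,
    phi Gx.1 <= (2 ^+ n.+1)^-1%:E & (1 - n.+1%:R^-1)%:E <= cesaro_measure p Gx.2 n Gx.1].
  by move=> n; have [G [x Gx]] := doeblin_violation n phif phis; exists (G, x).
move=> /choice[Gx HGx].
pose G n := (Gx n).1; pose x n := (Gx n).2; pose nu n := cesaro_measure p (x n) n.
have mG n : measurable (G n) by have [] := HGx n.
have phiG n : phi (G n) <= (2 ^+ n.+1)^-1%:E by have [] := HGx n.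
have nuG n : (1 - n.+1%:R^-1)%:E <= nu n (G n) by have [] := HGx n.
have harm0 : (n.+1%:R^-1 : R)%R @[n --> \oo] --> (0 : R)%R by exact: cvg_harmonic.
have nuT n : nu n setT = 1 by exact: cesaro_setT.
have [|mu [muT mus mul]] := stationary_limit_measure nuT.
  move=> E mE; apply: norm_cvg0.
  apply: (squeeze_cvgr _ (cvg_cst 0%R) harm0).
  by apply: nearW => n; rewrite normr_ge0 cesaro_defect.
exists mu, (lim_sup_set G).
have mtail n : measurable (\bigcup_(j >= n) G j) by exact: bigcup_measurable.
have mutail n : mu (\bigcup_(j >= n) G j) = 1.
  apply: (mul _ 1%R) => //.
  have cst1 : (1 - k.+1%:R^-1 : R)%R @[k --> \oo] --> (1 : R)%R.
    by rewrite -[X in _ --> X]subr0; apply: cvgB => //; exact: cvg_cst.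
  apply: (squeeze_cvgr _ cst1 (cvg_cst (1%R : R))).
  near=> k.
  have kn : (n <= k)%N by near: k; exact: nbhs_infty_ge.
  have nukf E : measurable E -> nu k E \is a fin_num.
    have nukT : nu k setT \is a fin_num by rewrite nuT.
    exact: fin_content.
  apply/andP; split; rewrite -lee_fin fineK ?nukf//.
    apply: le_trans (nuG k) _; apply: le_content => //.
    by move=> y Gy; exists k.
  by rewrite -(nuT k) le_content.
split => //.
- by apply: bigcap_measurable => // k _; exact: mtail.
- apply: lim_sup_set_cvg0 => //.
  apply: (@le_lt_trans _ _ (\sum_(n <oo) (1 / (2 ^ n.+1)%:R)%:E)).
    apply: lee_nneseries => // n _; apply: le_trans (phiG n) _.
    by rewrite lee_fin div1r natrX.
  apply: le_lt_trans (epsilon_trick0 _ _) _ => //.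
  by rewrite ltry.
- have : mu (\bigcup_(k >= n) G k) @[n --> \oo] --> mu (lim_sup_set G).
    by apply: lim_sup_set_cvg => //; rewrite mutail ltry.
  under eq_fun do rewrite mutail.
  by move=> /(cvg_unique (@ereal_hausdorff R) (cvg_cst _)).
Unshelve. all: by end_near. Qed.

End singular_stationary.

(** * The Doeblin condition from countable additivity *)

Section doeblin_of_stationary_ca.
Context d (X : measurableType d) (R : realType).
Variable p : R.-pker X ~> X.
Hypothesis stationary_ca : forall c : {content set X -> \bar R},
  c setT = 1 -> stationary p c -> semi_sigma_additive c.

(** Removing from [H n] all later sets yields disjoint [Y n] still carrying [mu n]. A limit [m] of
    the sequence gives mass 0 to each [Y i] but mass 1 to their union, which no measure does. *)
Lemma no_singular_stationary_sequence (mu : nat -> {measure set X -> \bar R})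
    (H : nat -> set X) :
  (forall n, mu n setT = 1) -> (forall n, stationary p (mu n)) ->
  (forall n, measurable (H n)) -> (forall n, mu n (H n) = 1) ->
  ~ (forall i n, (i < n)%N -> mu i (H n) = 0).
Proof.
move=> muT mus mH muH H0.
pose V n := \bigcup_k H (n.+1 + k)%N.
have mV n : measurable (V n) by exact: bigcup_measurable.
have muV n : mu n (V n) = 0.
  apply/eqP; rewrite eq_le measure_ge0 andbT.
  apply: le_trans (generalized_Boole_inequality (mu n) (fun k => mH _) (mV n)) _.
  by rewrite eseries0// => k _ _; rewrite H0// addSn ltnS leq_addr.
pose Y n := H n `\` V n.
have mY n : measurable (Y n) by exact: measurableD.
have muY n : mu n (Y n) = 1.
  have HF : mu n (H n) < +oo by rewrite muH ltry.
  have -> : mu n (Y n) = mu n (H n) - mu n (H n `&` V n) by exact: measureD.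
  rewrite muH (subset_measure0 _ _ _ (muV n)) ?sube0//; exact: measurableI.
have disj i j : (i < j)%N -> Y i `&` Y j = set0.
  move=> ij; apply/seteqP; split => // x [[_ nV] [Hj _]]; apply: nV.
  by exists (j - i.+1)%N => //; rewrite subnKC.
have mUY : measurable (\bigcup_i Y i) by exact: bigcup_measurable.
have [||m [mT ms ml]] := stationary_limit_measure stationary_ca (nu := mu).
- exact: muT.
- move=> E mE; rewrite (_ : (fun n => _) = fun=> (0 : R)%R); first exact: cvg_cst.
  by apply/funext => n; rewrite (mus n E mE) subrr.
have mYi i : m (Y i) = 0.
  apply: (ml _ 0%R) => //; apply: cvg_near_cst; near=> n.
  have i_n : (i < n)%N by near: n; exact: nbhs_infty_gt.
  suff /(congr1 fine) : mu n (Y i) = 0 by [].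
  apply/eqP; rewrite eq_le measure_ge0 andbT.
  have : mu n (Y i) + mu n (Y n) <= 1.
    rewrite -contentU// ?disj// -(muT n); apply: le_content => //.
    exact: measurableU.
  by rewrite muY -[leRHS]add0e leeD2rE.
have mU : m (\bigcup_i Y i) = 1.
  apply: (ml _ 1%R) => //; rewrite (_ : (fun n => _) = fun=> (1 : R)%R); first exact: cvg_cst.
  apply/funext => n; suff /(congr1 fine) : mu n (\bigcup_i Y i) = 1 by [].
  apply/eqP; rewrite eq_le -{1}(muT n) le_content//= -(muY n) le_content//.
  by move=> y Yy; exists n.
have : m (\bigcup_i Y i) <= 0.
  apply: le_trans (generalized_Boole_inequality m mY mUY) _.
  by rewrite eseries0.
by rewrite mU lee_fin ler10.
Unshelve. all: by end_near. Qed.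

Lemma stationary_ca_doeblin : doeblin_condition p.
Proof.
apply: contrapT => not_doeblin.
pose S := {m : {measure set X -> \bar R} | m setT \is a fin_num /\ stationary p m}.
have : forall s : S, exists mH : {measure set X -> \bar R} * set X,
    [/\ mH.1 setT = 1, stationary p mH.1, measurable mH.2,
      sval s mH.2 = 0 & mH.1 mH.2 = 1].
  move=> [phi [phif phis]].
  have [mu [H muH]] := singular_stationary stationary_ca not_doeblin phif phis.
  by exists (mu, H).
move=> /choice[g gP].
have s0P : (@mzero d X R) setT \is a fin_num /\ stationary p (@mzero d X R).
  by split => // E mE; rewrite integral_measure_zero.
have addP (s : S) : measure_add (sval s) (g s).1 setT \is a fin_num /\
    stationary p (measure_add (sval s) (g s).1).
  case: (gP s) => gT gs _ _ _; case: (svalP s) => sf ss; split.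
    by rewrite measure_addE gT fin_numD sf.
  move=> E mE; rewrite ge0_integral_measure_add//; last exact: measurable_kernel.
  by rewrite measure_addE ss// gs.
(* [st n] is the unnormalised sum of the [mu i] with [i < n], starting from the zero measure; a set
   null for [st n] is thus null for all earlier [mu i]. *)
pose st : nat -> S := fix st n :=
  if n is n'.+1 then exist _ _ (addP (st n')) else exist _ _ s0P.
pose mu n := (g (st n)).1; pose H n := (g (st n)).2.
have st_ge i n E : (i < n)%N -> mu i E <= sval (st n) E.
  have stS k : sval (st k.+1) E = sval (st k) E + mu k E by exact: measure_addE.
  elim: n => // n IH; rewrite ltnS leq_eqVlt stS => /predU1P[->|/IH iE].
    by rewrite leeDr.
  by apply: le_trans iE _; rewrite leeDl.
apply: (@no_singular_stationary_sequence mu H).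
- by move=> n; have [] := gP (st n).
- by move=> n; have [] := gP (st n).
- by move=> n; have [] := gP (st n).
- by move=> n; have [] := gP (st n).
move=> i n i_n; apply/eqP; rewrite eq_le measure_ge0 andbT.
by have [_ _ _ <- _] := gP (st n); exact: st_ge.
Qed.

End doeblin_of_stationary_ca.

(** * Translation between charges in [ba] and contents *)

Section charges_and_contents.
Context d (X : measurableType d) (R : realType).

Section nonneg_set_function.
Variables (mu : set X -> \bar R) (c : {content set X -> \bar R}).
Hypothesis muE : forall E, measurable E -> mu E = c E.

Lemma jordan_ba_posE E : measurable E -> jordan_ba_pos mu E = c E.
Proof.
move=> mE; apply/eqP; rewrite eq_le; apply/andP; split.
  by apply: ge_ereal_sup => _ [F [mF FE] <-]; rewrite muE// le_content.
by apply: ereal_sup_ubound; exists E; [split|exact: muE].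
Qed.

Lemma jordan_ba_negE E : jordan_ba_neg mu E = 0.
Proof.
apply/eqP; rewrite eq_le; apply/andP; split.
  by apply: ge_ereal_sup => _ [F [mF _] <-]; rewrite muE// oppe_le0.
by apply: ereal_sup_ubound; exists set0; [split|rewrite muE// measure0 oppe0].
Qed.

Lemma ba_integralE (f : X -> \bar R) : ba_integral mu f = \int[c]_x f x.
Proof.
rewrite /ba_integral (eq_integral_on_measurable _ jordan_ba_posE).
rewrite (@eq_integral_on_measurable _ _ _ (jordan_ba_neg mu) mzero).
  by rewrite integral_measure_zero sube0.
by move=> E _; exact: jordan_ba_negE.
Qed.

Lemma tv_normE : tv_norm mu = c setT.
Proof.
apply/eqP; rewrite eq_le; apply/andP; split.
  apply: ge_ereal_sup => _ [n [F [mF tF ->]]].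
  rewrite (eq_bigr (fun i : 'I_n => c (F i))); last first.
    by move=> i _; rewrite muE// gee0_abs.
  rewrite -measure_semi_additive//; last exact: bigsetU_measurable.
  by apply: le_content => //; exact: bigsetU_measurable.
(* The partition into one piece attains the supremum. *)
apply: ereal_sup_ubound; exists 1%N, (fun k => if k is 0%N then setT else set0).
split; first by case.
  by apply/trivIsetP => -[|i] [|j] // _ _ _; rewrite ?setI0 ?set0I.
by rewrite big_ord_recl big_ord0 adde0 muE// gee0_abs.
Qed.

Lemma semi_sigma_additive_eq : semi_sigma_additive mu <-> semi_sigma_additive c.
Proof.
split=> mus F mF tF mUF; have := mus F mF tF mUF; rewrite muE//.
  rewrite (_ : (fun n => _) = (fun n => \sum_(0 <= i < n) c (F i)))//.
  by apply/funext => n; apply: eq_bigr => i _; rewrite muE.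
rewrite (_ : (fun n => _) = (fun n => \sum_(0 <= i < n) mu (F i)))//.
by apply/funext => n; apply: eq_bigr => i _; rewrite muE.
Qed.

(** The positive part is [c] on measurable sets and the negative part is 0, so its condition is
    automatic. A measure below [c] has finite mass, hence may be taken as a [finite_measure]. *)
Lemma purely_finitely_additiveP : c setT \is a fin_num ->
  purely_finitely_additive mu <-> no_measure_below c.
Proof.
move=> cf; split=> [[pos _] m mc E mE|cp].
  have mf : m setT \is a fin_num.
    by rewrite ge0_fin_numE// (le_lt_trans (mc _ measurableT))// -ge0_fin_numE.
  apply: (pos (finite_measure_of mf)) => // F mF.
  by rewrite jordan_ba_posE// mc.
split=> lambda lmu E mE.
  by apply: cp => // F mF; rewrite -jordan_ba_posE// lmu.
by apply/eqP; rewrite eq_le measure_ge0 andbT -(jordan_ba_negE E) lmu.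
Qed.

End nonneg_set_function.

Section content_charge.
Variable c : {content set X -> \bar R}.

Definition content_charge & c setT \is a fin_num : set X -> \bar R := c.

Hypothesis cfin : c setT \is a fin_num.

Let content_charge_fin : fin_num_fun (content_charge cfin).
Proof. by move=> E mE; exact: fin_content. Qed.

HB.instance Definition _ := isFinite.Build d X R (content_charge cfin)
  content_charge_fin.

Let content_charge_additive : measure_function.semi_additive (content_charge cfin).
Proof. exact: measure_semi_additive. Qed.

HB.instance Definition _ := isAdditiveCharge.Build d X R (content_charge cfin)
  content_charge_additive.

End content_charge.

(** The charge is nonnegative on measurable sets only, so the content is rebuilt from its real
    values there. *)
Lemma charge_content (mu : additive_charge X R) :
  (forall E, measurable E -> 0 <= mu E) ->
  exists c : {content set X -> \bar R}, forall E, measurable E -> mu E = c E.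
Proof.
move=> mu0; have muf E : measurable E -> mu E \is a fin_num by exact: fin_num_measure.
have muset0 : mu set0 = 0.
  have := @charge_semi_additive _ _ _ mu (fun=> set0) 0%N; rewrite !big_ord0.
  by apply => //; exact: trivIset_set0.
have mu_additive2 : additive2 mu.
  by apply/(additive2P muset0); exact: charge_semi_additive.
have fa : nonneg_additive (fine \o mu).
  split=> [E mE|A B mA mB AB] /=; first by rewrite fine_ge0// mu0.
  by rewrite mu_additive2// fineD// muf.
exists (additive_content fa) => E mE.
by rewrite /= additive_contentE//= fineK// muf.
Qed.

Variable p : R.-pker X ~> X.

Lemma Delta_ba_content (mu : additive_charge X R) : Delta_ba p mu ->
  exists c : {content set X -> \bar R},
    [/\ forall E, measurable E -> mu E = c E, c setT = 1 & stationary p c].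
Proof.
move=> [[_ mu0 tv] inv]; have [c muc] := charge_content mu0.
exists c; split => //; first by rewrite -(tv_normE muc).
by move=> E mE; rewrite -(ba_integralE muc) -muc//; exact: inv.
Qed.

Lemma content_Delta_ba (c : {content set X -> \bar R}) :
  c setT = 1 -> stationary p c ->
  exists2 mu : additive_charge X R, Delta_ba p mu & forall E, mu E = c E.
Proof.
move=> cT cs; have cf : c setT \is a fin_num by rewrite cT.
pose mu : additive_charge X R := content_charge cf.
have muc E : measurable E -> mu E = c E by [].
exists mu => //; split.
  split=> [||]; last by rewrite (tv_normE muc).
    exists 1%R => E mE; rewrite muc// gee0_abs// -cT.
    exact: le_content.
  by move=> E mE; rewrite muc.
by move=> E mE; rewrite /markov_operator (ba_integralE muc) cs.
Qed.

Lemma Delta_ba_subset_caP : Delta_ba p `<=` ca <->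
  forall c : {content set X -> \bar R},
    c setT = 1 -> stationary p c -> semi_sigma_additive c.
Proof.
split=> [Dca c cT cs|stat mu muD].
  have [mu muD muc] := content_Delta_ba cT cs.
  by have [_] := Dca _ muD; rewrite (semi_sigma_additive_eq (fun E _ => muc E)).
have [c [muc cT cs]] := Delta_ba_content muD.
split; first by case: muD => -[].
by rewrite (semi_sigma_additive_eq muc); exact: stat.
Qed.

Lemma Delta_ba_purely_finitely_additiveP :
  (exists mu : additive_charge X R, Delta_ba p mu /\ purely_finitely_additive mu) <->
  (exists q : {content set X -> \bar R},
    [/\ q setT = 1, stationary p q & no_measure_below q]).
Proof.
split=> [[mu [/Delta_ba_content[c [muc cT cs]] mup]]|[q [qT qs qp]]].
  exists c; split => //; apply/(purely_finitely_additiveP muc) => //.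
  by rewrite cT.
have [mu muD muq] := content_Delta_ba qT qs.
exists mu; split => //; apply/(purely_finitely_additiveP (fun E _ => muq E)) => //.
by rewrite qT.
Qed.

End charges_and_contents.

(** A countably additive [q] of mass 1 is itself a nonzero measure below [q]; the converse is the
    extraction of a pure part. *)
Lemma stationary_caP d (X : measurableType d) (R : realType) (p : R.-pker X ~> X) :
  (forall c : {content set X -> \bar R},
    c setT = 1 -> stationary p c -> semi_sigma_additive c) <->
  ~ exists q : {content set X -> \bar R},
    [/\ q setT = 1, stationary p q & no_measure_below q].
Proof.
split=> [stat [q [qT qs qp]]|nq c cT cs].
  have [m mq] := measure_of_content (stat q qT qs).
  have : q setT = 0 by rewrite -mq; apply: qp => // E mE; rewrite mq.
  by rewrite qT => /eqP; rewrite onee_eq0.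
apply: contrapT => cnot; apply: nq; apply: exists_pure_stationary cnot => //.
by rewrite cT.
Qed.

Local Close Scope ereal_scope.

Theorem theorem4p4 (R : realType) (d : measure_display) (X : measurableType d)
    (X_infinite : infinite_set [set: X])
    (measurable_singleton : forall x : X, measurable [set x])
    (p : R.-pker X ~> X) :
  (doeblin_condition p <-> Delta_ba p `<=` ca) /\
  (Delta_ba p `<=` ca <->
    ~ (exists mu : {additive_charge set X -> \bar R},
         Delta_ba p mu /\ purely_finitely_additive mu)).
Proof.
(* Both conditions on charges become the same statement about stationary contents, so the second
   equivalence turns trivial. *)
rewrite Delta_ba_subset_caP Delta_ba_purely_finitely_additiveP -stationary_caP.
split=> //; split=> [doeblin|]; last exact: stationary_ca_doeblin.
apply/stationary_caP => -[q [qT qs qp]].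
exact: (doeblin_no_pure_stationary qT qs qp).
Qed.
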